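(* Let $P$ be a poset and let $\varphi:P\rightarrow P$ be a monotone map. Let $Q$ be a subset of $P$ (with the induced order) such that $P\supseteq Q\supseteq\mathrm{Fix}\,\varphi$, $P\setminus Q$ is finite, and for every $x\in P\setminus Q$ the set $P_{<x}\cup P_{>x}$ is finite. Then $\Delta(P)\searrow_{\mathtt{NE}}\Delta(Q)$; in particular, $\Delta(P)$ collapses onto $\Delta(Q)$.
   Context: For a poset $P$, $\Delta(P)$ denotes its order complex (nerve): the simplicial complex whose simplices are the (finite) chains of $P$. $P_{<x}=\{y\in P: y<x\}$, $P_{>x}=\{y\in P:y>x\}$. An order-preserving map $\varphi:P\rightarrow P$ is monotone if for every $x\in P$ either $x\geq\varphi(x)$ or $x\leq\varphi(x)$; $\mathrm{Fix}\,\varphi$ is its set of fixed points. A finite nonempty simplicial complex $X$ is nonevasive if either $X$ is a point, or, inductively, there is a vertex $v$ of $X$ such that both the deletion $X\setminus\{v\}$ and the link $\mathrm{lk}_X v$ are nonevasive. For nonempty simplicial complexes $X\supseteq Y$, we write $X\searrow_{\mathtt{NE}} Y$ (NE-reduction) if there is a sequence $X=A_1\supset A_2\supset\dots\supset A_t=Y$ such that for each $i\in\{1,\dots,t-1\}$ we have $V(A_i)=V(A_{i+1})\cup\{x_i\}$ (with $A_{i+1}$ obtained from $A_i$ by deleting the vertex $x_i$) and $\mathrm{lk}_{A_i}x_i$ is nonevasive; here $V(\cdot)$ denotes the vertex set. An elementary collapse removes two open simplices $\sigma,\tau$ with $\dim\sigma=\dim\tau+1$ such that $\sigma$ is the only simplex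 other than $\tau$ containing $\tau$ in its closure; $X$ collapses onto a subcomplex $Y$ if $Y$ is reached from $X$ by a sequence of elementary collapses. *)

(* Defs.v *)
From HB Require Import structures.
From mathcomp Require Import all_boot all_order finmap.
From mathcomp Require Import all_classical.
From Stdlib Require Import Relation_Operators.

Set Implicit Arguments.
Unset Strict Implicit.
Unset Printing Implicit Defensive.

Import Order.Theory.
Local Open Scope order_scope.
Local Open Scope classical_set_scope.

(* Simplices are nonempty: the empty simplex is never an element of a
   complex, so that it cannot take part in a collapse. *)
Record complex (T : choiceType) := Complex {
  simplices :> {fset T} -> Prop;
  simplex_neq0 : forall s : {fset T}, simplices s -> s != fset0;
  simplex_face : forall s t : {fset T},
    simplices s -> (t `<=` s)%fset -> t != fset0 -> simplices t }.

Lemma complex_eq (T : choiceType) (X Y : complex T) :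
  simplices X = simplices Y -> X = Y.
Proof.
case: X Y => [X X0 XF] [Y Y0 YF] /= eqXY; case: Y / eqXY Y0 YF => Y0 YF.
by congr Complex; exact: Prop_irrelevance.
Qed.

Section Complexes.
Variable T : choiceType.
Implicit Types (X Y : complex T) (v : T) (s t : {fset T}).

Definition vertex X v : Prop := X [fset v]%fset.

Program Definition deletion X v : complex T :=
  @Complex T [set s | X s /\ v \notin s] _ _.
Next Obligation. by move=> X v s [/simplex_neq0]. Qed.
Next Obligation.
move=> X v s t [Xs vs] ts t0; split; first exact: simplex_face Xs ts t0.
by apply: contra vs => /(fsubsetP ts).
Qed.

Program Definition link X v : complex T :=
  @Complex T [set s | [/\ X s, v \notin s & X (v |` s)%fset]] _ _.
Next Obligation. by move=> X v s [/simplex_neq0]. Qed.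
Next Obligation.
move=> X v s t [Xs vs Xvs] ts t0; split; first exact: simplex_face Xs ts t0.
  by apply: contra vs => /(fsubsetP ts).
apply: simplex_face Xvs _ _; first exact: fsetUS.
by apply/fset0Pn; exists v; rewrite fset1U1.
Qed.

Definition is_point X : Prop := exists v, simplices X = [set [fset v]%fset].

(* Every complex satisfying this predicate is finite and nonempty, see
   nonevasive_finite and nonevasive_nonempty. *)
Inductive nonevasive : complex T -> Prop :=
| nonevasive_point X : is_point X -> nonevasive X
| nonevasive_vertex X v : vertex X v ->
    nonevasive (deletion X v) -> nonevasive (link X v) -> nonevasive X.

Definition NE_step X Y : Prop :=
  exists v, [/\ vertex X v, nonevasive (link X v) & Y = deletion X v].

(* Nonemptiness of the complexes is not imposed: it propagates from X to Y
   (NE_reduces_nonempty), and the empty complex only reduces to itself. *)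
Definition NE_reduces : complex T -> complex T -> Prop :=
  clos_refl_trans (complex T) NE_step.

Definition elementary_collapse X Y : Prop :=
  exists s t : {fset T},
    [/\ X s /\ X t,
        #|` s| = #|` t|.+1,
        (forall r, X r -> (t `<=` r)%fset /\ r <> t <-> r = s) &
        simplices Y = simplices X `\` [set s; t]].

Definition collapses : complex T -> complex T -> Prop :=
  clos_refl_trans (complex T) elementary_collapse.

Lemma nonevasive_nonempty X : nonevasive X -> simplices X !=set0.
Proof.
case=> {}X => [[v ->]|v Xv _ _]; first by exists [fset v]%fset.
by exists [fset v]%fset.
Qed.

Lemma nonevasive_finite X : nonevasive X -> finite_set (simplices X).
Proof.
elim=> {}X => [[v ->]|v Xv _ finD _ finL]; first exact: finite_set1.
apply: (@sub_finite_set _ _ (simplices (deletion X v) `|`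
  ([set [fset v]%fset] `|` (fun s => (v |` s)%fset) @` simplices (link X v)))).
  move=> s Xs; case: (boolP (v \in s)) => vs; last by left.
  right; case: (eqVneq (s `\ v)%fset fset0) => [s0|sn0].
    by left => /=; rewrite -(fsetD1K vs) s0 fsetU0.
  right; exists (s `\ v)%fset; last exact: fsetD1K.
  split; rewrite ?fsetD1K //; last by rewrite !inE eqxx.
  by apply: simplex_face Xs _ sn0; exact: fsubD1set.
by rewrite !finite_setU; do ![split=> //]; exact: finite_image.
Qed.

Lemma NE_reduces_nonempty X Y :
  NE_reduces X Y -> simplices X !=set0 -> simplices Y !=set0.
Proof.
elim=> {X Y} [X Y [v [_ /nonevasive_nonempty[s [Xs vs _]] ->]] _|//|X Y Z _ XY _ YZ /XY/YZ//].
by exists s.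
Qed.

End Complexes.

Section Posets.
Variables (d : Order.disp_t) (P : porderType d).
Implicit Types (Q : set P) (phi : P -> P).

(* The order complex of Q with the order induced from P, as a complex of
   finite subsets of P. *)
Program Definition order_complex Q : complex P :=
  @Complex P [set s : {fset P} |
    [/\ s != fset0, (forall x, x \in s -> Q x)
      & {in s &, forall x y, (x <= y) || (y <= x)}]] _ _.
Next Obligation. by move=> Q s []. Qed.
Next Obligation.
move=> Q s t [_ sQ sC] /fsubsetP ts t0; split=> // [x /ts/sQ//|x y xt yt].
by apply: sC; exact: ts.
Qed.

Definition monotone_map phi : Prop :=
  {homo phi : x y / x <= y} /\ forall x, phi x <= x \/ x <= phi x.

Definition Fix phi : set P := [set x | phi x = x].

End Posets.

(* Main.v *)
Require Import Defs.
From mathcomp Require Import all_boot all_order finmap.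
From mathcomp Require Import all_classical.
From Stdlib Require Import Relation_Operators.

Set Implicit Arguments.
Unset Strict Implicit.
Unset Printing Implicit Defensive.

Import Order.Theory.
Local Open Scope order_scope.
Local Open Scope classical_set_scope.

(** A monotone map splits into the decreasing map [min id phi] and the
    increasing map [max id phi].  The points of [P \ Q] moved down by [phi] are
    deleted from the top to the bottom; when [x] is deleted, the part of the link
    below [x] is still all of [P_{<x}], and [y >= min y (phi y) <= phi x] contracts
    it conically.  Such a conical contraction is turned into a nonevasiveness
    proof by deleting a maximal element not below [phi x], the link of which
    is contracted in the same way.  The points moved up are treated dually.
    Collapsibility follows since a collapse of the link of [v] to a point [p],
    coned off by [v], ends with the free pair [{v} < {v, p}]. *)

(** * Nonevasiveness and collapses *)

Section Collapses.
Variable T : choiceType.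
Implicit Types (X Y L M : complex T) (v : T).

(** For [L] inside the link of [v], this is the deletion of [v] with the cone of apex [v] over [L]
    glued on. Cutting down to [X] makes it a complex for arbitrary [L]. *)
Program Definition cone_over_deletion X v L : complex T :=
  @Complex T [set s | X s /\
    [\/ v \notin s, s = [fset v]%fset | L (s `\ v)%fset]] _ _.
Next Obligation. by move=> X v L s [/simplex_neq0]. Qed.
Next Obligation.
move=> X v L s t [Xs Hs] ts t0; split; first exact: simplex_face Xs ts t0.
have [vt|] := boolP (v \in t); last by constructor 1.
have vs := fsubsetP ts _ vt.
have [tv0|tv0] := eqVneq (t `\ v)%fset fset0.
  by constructor 2; rewrite -(fsetD1K vt) tv0 fsetU0.
case: Hs => [|seq|Ls]; first by rewrite vs.
  move: tv0; rewrite -fsubset0 => /negP[]; apply/fsubsetP => z.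
  rewrite !inE => /andP[zv /(fsubsetP ts)]; rewrite seq inE.
  by rewrite (negPf zv).
by constructor 3; apply: simplex_face Ls _ tv0; exact: fsetSD.
Qed.

Lemma cone_over_deletion_link X v :
  cone_over_deletion X v (link X v) = X.
Proof.
apply: complex_eq; apply/seteqP; split=> s /=; first by case.
move=> Xs; split=> //.
have [vs|] := boolP (v \in s); last by constructor 1.
have [s0|s0] := eqVneq (s `\ v)%fset fset0.
  by constructor 2; rewrite -(fsetD1K vs) s0 fsetU0.
constructor 3; split; rewrite ?fsetD1K //; last by rewrite !inE eqxx.
by apply: simplex_face Xs _ s0; exact: fsubD1set.
Qed.

Lemma cone_elementary_collapse X v L M :
  simplices L `<=` simplices (link X v) -> elementary_collapse L M ->
  elementary_collapse (cone_over_deletion X v L) (cone_over_deletion X v M).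
Proof.
move=> LX [s [t [[Ls Lt] cst free ML]]].
have [Xs vs Xvs] := LX _ Ls; have [Xt vt Xvt] := LX _ Lt.
have coneP u : v \notin u -> L u -> X (v |` u)%fset ->
    cone_over_deletion X v L (v |` u)%fset.
  by move=> vu Lu Xu; split=> //; constructor 3; rewrite fsetU1K.
exists (v |` s)%fset, (v |` t)%fset; split.
- by split; exact: coneP.
- by rewrite !cardfsU1 vs vt cst.
- have [ts st] : (t `<=` s)%fset /\ s <> t by exact/(free s Ls).
  move=> r [Xr Hr]; split=> [[tr rt]|->].
    have vr : v \in r by apply: (fsubsetP tr); rewrite fset1U1.
    have tr' : (t `<=` r `\ v)%fset.
      by rewrite -(fsetU1K vt); exact: fsetSD.
    (* [r] cannot be the apex alone, since [t] would then be empty. *)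
    case: Hr => [|req|Lr]; first by rewrite vr.
      have := simplex_neq0 Xt; move: tr'.
      by rewrite req fsetDv fsubset0 => ->.
    rewrite -(fsetD1K vr); congr (v |` _)%fset; apply/(free _ Lr); split=> //.
    by move=> rvt; apply: rt; rewrite -rvt fsetD1K.
  split; first exact: fsetUS.
  by move=> e; apply: st; rewrite -(fsetU1K vs) e fsetU1K.
- apply/seteqP; split=> r /=; rewrite ML.
    case=> Xr Hr; split.
      by split=> //; case: Hr => [?|?|[? _]];
        [constructor 1|constructor 2|constructor 3].
    case: Hr => [vr|req|[_ nr]].
    + by case=> req; move: vr; rewrite req fset1U1.
    + case=> e; move: req; rewrite e => e'.
        have := simplex_neq0 Xs.
        by rewrite -(fsetU1K vs) e' fsetDv eqxx.
      have := simplex_neq0 Xt.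
      by rewrite -(fsetU1K vt) e' fsetDv eqxx.
    + by move=> [e|e]; apply: nr; rewrite e fsetU1K //; [left|right].
  case=> -[Xr Hr] nr; split=> //.
  have [vr|] := boolP (v \in r); last by constructor 1.
  case: Hr => [|?|Lr]; first by rewrite vr.
    by constructor 2.
  constructor 3; split=> //= -[e|e]; apply: nr; [left|right];
    by rewrite -e fsetD1K.
Qed.

(** The inclusion of [M] in [L] keeps later stages of the collapse inside the link, as chaining the
    steps requires. *)
Lemma cone_collapses X v L M : collapses L M ->
  simplices L `<=` simplices (link X v) ->
  collapses (cone_over_deletion X v L) (cone_over_deletion X v M) /\
  simplices M `<=` simplices L.
Proof.
elim=> {L M} [L M LM LX|L _|L M N _ IH1 _ IH2 LX].
- split; first by apply: rt_step; exact: cone_elementary_collapse.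
  by case: LM => s [t [_ _ _ ->]] r [].
- by split=> //; exact: rt_refl.
- have [c1 ML] := IH1 LX; have [c2 NM] := IH2 (subset_trans ML LX).
  by split; [exact: rt_trans c1 c2|exact: subset_trans NM ML].
Qed.

Lemma cone_point_collapse X v L : vertex X v -> is_point L ->
  simplices L `<=` simplices (link X v) ->
  elementary_collapse (cone_over_deletion X v L) (deletion X v).
Proof.
move=> Xv [p Lp] LX.
have [Xp vp Xvp] : link X v [fset p]%fset by apply: LX; rewrite Lp.
exists (v |` [fset p])%fset, [fset v]%fset; split.
- split; split=> //; last by constructor 2.
  by constructor 3; rewrite fsetU1K // Lp.
- by rewrite cardfsU1 vp !cardfs1.
- move=> r [Xr Hr]; split=> [[vr rv]|->].
    rewrite fsub1set in vr; case: Hr => [|//|]; first by rewrite vr.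
    by rewrite Lp => /= e; rewrite -(fsetD1K vr) e.
  split; first exact: fsubsetUl.
  move=> /fsetP/(_ p); rewrite !inE eqxx orbT => /esym/eqP pv.
  by move: vp; rewrite pv inE eqxx.
- apply/seteqP; split=> r /=.
    case=> Xr vr; split; first by split=> //; constructor 1.
    by case=> e; move: vr; rewrite e !inE eqxx.
  case=> -[Xr Hr] nr; split=> //; apply/negP => vr; apply: nr.
  case: Hr => [|->|]; [by rewrite vr|by right|].
  by rewrite Lp => /= e; left; rewrite -(fsetD1K vr) e.
Qed.

(** [X] is the deletion with the full link coned off. The coned collapse shrinks this cone to a
    single edge at [v], which is then removed together with [v]. *)
Lemma deletion_collapses X v L : vertex X v -> is_point L ->
  collapses (link X v) L -> collapses X (deletion X v).
Proof.
move=> Xv Lp /(@cone_collapses X v)/(_ (@subset_refl _ _))[].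
rewrite cone_over_deletion_link => XY LX; apply: rt_trans XY _.
by apply: rt_step; exact: cone_point_collapse.
Qed.

Lemma nonevasive_collapses X :
  nonevasive X -> exists2 L, is_point L & collapses X L.
Proof.
elim=> {}X => [Xp|v Xv _ [L Lp DL] _ [M Mp LM]].
  by exists X => //; exact: rt_refl.
by exists L => //; apply: rt_trans DL; exact: deletion_collapses LM.
Qed.

Lemma NE_reduces_collapses X Y : NE_reduces X Y -> collapses X Y.
Proof.
elim=> {X Y} [X Y [v [Xv /nonevasive_collapses[L Lp XL] ->]]|X|X Y Z _ ? _].
- exact: deletion_collapses XL.
- exact: rt_refl.
- exact: rt_trans.
Qed.

End Collapses.

(** * Order complexes *)

Lemma card_fsubsetD1 (T : choiceType) (A B : {fset T}) x :
  x \in A -> (B `<=` A `\ x)%fset -> (#|` B| < #|` A|)%N.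
Proof.
move=> xA /fsubset_leq_card BA; apply: leq_ltn_trans BA _.
by rewrite [ltnRHS](cardfsD1 x) xA.
Qed.

Lemma ex_minimal_fset (d : Order.disp_t) (P : porderType d) (A : {fset P}) :
  A != fset0 -> exists2 x, x \in A & forall y, y \in A -> ~~ (y < x).
Proof.
have [n] := ubnP #|` A|; elim: n A => // n IH A ltAn /fset0Pn[x xA].
(* Either [x] is minimal, or a minimal element of [B] is also minimal in [A]. *)
pose B := [fset y in A | y < x]%fset.
have [B0|/IH[|y]] := eqVneq B fset0.
- exists x => // y yA; apply/negP => yx.
  by have := in_fset0 y; rewrite -B0 !inE yA yx.
- apply: leq_trans (ltnSE ltAn); apply: (@card_fsubsetD1 _ _ _ x) => //.
  apply/fsubsetP => y; rewrite !inE => /andP[-> yx].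
  by rewrite (lt_eqF yx).
- rewrite !inE => /andP[yA yx] ymin; exists y => // z zA.
  apply/negP => zy; have := ymin z.
  by rewrite !inE zA (lt_trans zy yx) zy => /(_ isT).
Qed.

Lemma ex_maximal_fset (d : Order.disp_t) (P : porderType d) (A : {fset P}) :
  A != fset0 -> exists2 x, x \in A & forall y, y \in A -> ~~ (x < y).
Proof. exact: (@ex_minimal_fset _ P^d). Qed.

Section OrderComplexes.
Variables (d : Order.disp_t) (P : porderType d).
Implicit Types (S R : set P) (A B D : {fset P}) (x y a : P).

(** * Vertices, deletions and links in order complexes *)

Lemma order_complex_vertex S x : S x -> vertex (order_complex S) x.
Proof.
move=> Sx; split=> [|y|y z]; rewrite ?inE.
- by apply/fset0Pn; exists x; rewrite inE.
- by move=> /eqP->.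
- by move=> /eqP-> /eqP->; rewrite lexx.
Qed.

Lemma deletion_order_complex S x :
  deletion (order_complex S) x = order_complex (S `\ x).
Proof.
apply: complex_eq; apply/seteqP; split=> s /=.
  case=> -[s0 sS sC] xs; split=> // y ys; split; first exact: sS.
  by move=> yx; move: xs; rewrite -yx ys.
case=> s0 sS sC; split; first by split=> // y /sS[].
by apply/negP => /sS[_]; exact.
Qed.

Lemma link_order_complex S x : S x ->
  link (order_complex S) x = order_complex (S `&` [set y | y < x \/ x < y]).
Proof.
move=> Sx; apply: complex_eq; apply/seteqP; split=> s /=.
  case=> -[s0 sS sC] xs [_ _ xsC]; split=> // y ys; split; first exact: sS.
  have yx : y != x by apply: contraNneq xs => <-.
  have := xsC y x; rewrite !inE eqxx ys orbT => /(_ isT isT).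
  by rewrite !le_eqVlt (eq_sym x) (negPf yx) /= => /orP.
case=> s0 sS sC; split; first by split=> // y /sS[].
  by apply/negP => /sS[_ /=]; rewrite ltxx => -[].
split=> [|y|y z]; first by apply/fset0Pn; exists x; rewrite !inE eqxx.
  by rewrite !inE => /orP[/eqP->//|/sS[]].
rewrite !inE => /orP[/eqP->|ys] /orP[/eqP->|zs]; rewrite ?lexx //.
- by case: (sS z zs) => _ [/ltW->|/ltW->]; rewrite ?orbT.
- by case: (sS y ys) => _ [/ltW->|/ltW->]; rewrite ?orbT.
- exact: sC.
Qed.

(** Any vertex [x] other than [a] may be deleted: its deletion and its link both come from smaller
    sets that still contain [a], so induction on the size applies. *)
Lemma nonevasive_cone A a : a \in A -> {in A, forall y, y >=< a} ->
  nonevasive (order_complex [set` A]).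
Proof.
have [n] := ubnP #|` A|; elim: n A => // n IH A ltAn aA aC.
have [A1|] := eqVneq (A `\ a)%fset fset0.
  apply: nonevasive_point; exists a; rewrite -(fsetD1K aA) A1 fsetU0.
  apply/seteqP; split=> s /=.
    case=> s0 sa _; apply/eqP; rewrite eqEfsubset fsub1set.
    have sub : (s `<=` [fset a])%fset by apply/fsubsetP => y /sa.
    by rewrite sub /=; case/fset0Pn: s0 => y ys; have := sa _ ys;
      rewrite /= inE => /eqP <-.
  by move=> ->; apply: order_complex_vertex; rewrite /= inE.
case/fset0Pn=> x; rewrite !inE => /andP[xa xA].
have smaller B : (B `<=` A `\ x)%fset -> (#|` B| < n)%N.
  by move=> /(card_fsubsetD1 xA) lt; exact: leq_trans lt (ltnSE ltAn).
apply: (@nonevasive_vertex _ _ x); first exact: order_complex_vertex.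
  rewrite deletion_order_complex.
  have -> : [set` A] `\ x = [set` (A `\ x)%fset].
    apply/seteqP; split=> y /=; rewrite !inE.
      by case=> -> /eqP ->.
    by case/andP => /eqP.
  apply: IH; rewrite ?smaller // ?inE ?aA 1?eq_sym ?xa // => y.
  by rewrite !inE => /andP[_]; exact: aC.
rewrite link_order_complex //.
have -> : [set` A] `&` [set y | y < x \/ x < y] =
    [set` [fset y in A | (y < x) || (x < y)]%fset].
  apply/seteqP; split=> y /=; rewrite !inE /=.
    by case=> -> /orP.
  by case/andP=> -> /orP.
apply: IH.
- apply: smaller; apply/fsubsetP => y; rewrite !inE => /andP[-> yx].
  by rewrite andbT; apply: contraTneq yx => ->; rewrite ltxx.
- rewrite !inE aA /=; move: (aC x xA); rewrite /Order.comparable !le_eqVlt.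
  by rewrite (eq_sym a) (negPf xa) orbC.
- by move=> y; rewrite !inE => /andP[] /aC.
Qed.

(* The set [B] above [A] is carried along so that joins of complexes are
   not needed. *)
Lemma nonevasive_conically_contractible (f : P -> P) A B a :
  {in A & B, forall x y, x < y} ->
  {homo f : x y / x <= y} -> (forall x, f x <= x) ->
  {in A, forall x, f x \in A /\ f x <= a} -> a \in A ->
  nonevasive (order_complex [set` (A `|` B)%fset]).
Proof.
move=> + fH fle; have [n] := ubnP #|` A|.
elim: n A a => // n IH A a ltAn AB fA aA.
(* If all of [A] lies below [a], then [a] is a cone point, as [B] lies above it. Otherwise a maximal
   [x] among the elements not below [a] is deleted. *)
have [C0|/ex_maximal_fset[x]] :=
    eqVneq [fset y in A | ~~ (y <= a)]%fset fset0.
  apply: (@nonevasive_cone _ a); first by rewrite inE aA.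
  move=> y; rewrite inE => /orP[yA|yB]; last first.
    by rewrite comparable_sym; exact/lt_comparable/AB.
  apply: le_comparable; apply/negPn/negP => ya.
  by have := in_fset0 y; rewrite -C0 !inE yA ya.
rewrite !inE => /andP[xA xa] xmax.
(* Elements above [x] are not below [a] either, so [x] is maximal in all of [A]. *)
have {}xmax y : y \in A -> ~~ (x < y).
  move=> yA; apply/negP => xy; have := xmax y; rewrite !inE yA xy /=.
  suff -> : ~~ (y <= a) by move/(_ isT).
  by apply: contra xa; apply: le_trans; exact: ltW.
have smaller C : (C `<=` A `\ x)%fset -> (#|` C| < n)%N.
  by move=> /(card_fsubsetD1 xA) lt; exact: leq_trans lt (ltnSE ltAn).
have xB : x \notin B by apply/negP => /(AB x x xA); rewrite ltxx.
apply: (@nonevasive_vertex _ _ x).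
- by apply: order_complex_vertex; rewrite /= inE xA.
- rewrite deletion_order_complex.
  have -> : [set` (A `|` B)%fset] `\ x = [set` ((A `\ x) `|` B)%fset].
    apply/seteqP; split=> y /=; rewrite !inE.
      by case=> + /eqP yx; rewrite yx.
    case/orP=> [/andP[/eqP ? ->]//|yB]; rewrite yB orbT; split=> // yx.
    by rewrite -yx yB in xB.
  (* The values of [f] on [A] are below [a], hence never [x], so [f] still acts on the smaller
     set. *)
  apply: (IH _ a); rewrite ?smaller //.
  + by move=> y z; rewrite !inE => /andP[_]; exact: AB.
  + move=> y; rewrite !inE => /andP[_ /fA[-> fya]]; split=> //.
    by rewrite andbT; apply: contraNneq xa => <-.
  + by rewrite !inE aA andbT; apply: contraNneq xa => ->.
- rewrite link_order_complex; last by rewrite /= inE xA.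
  have -> : [set` (A `|` B)%fset] `&` [set y | y < x \/ x < y] =
      [set` ([fset y in A | (y < x)] `|` B)%fset].
    apply/seteqP; split=> y /=; rewrite !inE /=.
      case=> /orP[yA|->]; last by rewrite orbT.
      by case=> [->|xy]; rewrite ?yA //; have := xmax _ yA; rewrite xy.
    case/orP=> [/andP[-> ->]|yB]; first by split=> //; left.
    by rewrite yB orbT; split=> //; right; exact: AB.
  have [fxA fxa] := fA x xA.
  have fxx : f x < x.
    by rewrite lt_neqAle fle andbT; apply: contraNneq xa => <-.
  (* In the link [f x] takes over the role of [a]: [y < x] gives [f y <= f x]. *)
  apply: (IH _ (f x)).
  + apply: smaller; apply/fsubsetP => y; rewrite !inE => /andP[-> yx].
    by rewrite andbT (lt_eqF yx).
  + by move=> y z; rewrite !inE => /andP[yA _]; exact: AB.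
  + move=> y; rewrite !inE => /andP[/fA[-> _] yx]; split; last exact/fH/ltW.
    exact: le_lt_trans (fle y) yx.
  + by rewrite !inE fxA.
Qed.

(** Induction on [D], a minimal element being deleted last. A general [f]-stable [R] allows a second
    reduction to start where a first one ended. *)
Lemma NE_reduces_decreasing (f : P -> P) R D :
  {homo f : x y / x <= y} -> (forall x, f x <= x) ->
  (forall x, R x -> R (f x)) ->
  {in D, forall x, [/\ R x, f x <> x &
    finite_set ([set y | y < x] `|` [set y | x < y])]} ->
  NE_reduces (order_complex R) (order_complex (R `\` [set` D])).
Proof.
move=> fH fle fR; have [n] := ubnP #|` D|; elim: n D => // n IH D ltDn DP.
have [->|/ex_minimal_fset[x xD xmin]] := eqVneq D fset0.
  by rewrite set_fset0 setD0; exact: rt_refl.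
have [Rx fx fin] := DP x xD.
pose S := R `\` [set` (D `\ x)%fset].
have Sx : S x by split=> //=; rewrite !inE eqxx.
have fxx : f x < x by rewrite lt_neqAle fle andbT; exact/eqP.
apply: (@rt_trans _ _ _ (order_complex S)).
  apply: IH => [|y]; last by rewrite !inE => /andP[_]; exact: DP.
  by apply: leq_trans (ltnSE ltDn); exact: (card_fsubsetD1 xD).
apply: rt_step; exists x; split; first exact: order_complex_vertex.
  (* The link of [x] in [S] splits into a lower part [A] and an upper part [B]. By minimality of [x]
     nothing below it was deleted, so [A] may be taken in [R], where [f] acts. *)
  have [/finite_fsetP[A AE] /finite_fsetP[B BE]] :
      finite_set (R `&` [set y | y < x]) /\ finite_set (S `&` [set y | x < y]).
    by move: fin; rewrite finite_setU => -[? ?]; split; exact: finite_setIr.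
  have inA y : (y \in A) <-> R y /\ y < x by rewrite -[is_true _]/([set` A] y) -AE.
  have inB y : (y \in B) <-> S y /\ x < y by rewrite -[is_true _]/([set` B] y) -BE.
  rewrite link_order_complex //.
  have -> : S `&` [set y | y < x \/ x < y] = [set` (A `|` B)%fset].
    apply/seteqP; split=> y /=; rewrite inE.
      case=> Sy [yx|xy]; apply/orP; last by right; apply/inB.
      by left; apply/inA; case: Sy.
    case/orP=> [/inA[Ry yx]|/inB[Sy xy]]; last by split=> //; right.
    split; last by left.
    by split=> //=; rewrite !inE => /andP[_ /xmin]; rewrite yx.
  apply: (@nonevasive_conically_contractible f _ _ (f x)) => //.
  - by move=> y z /inA[_ yx] /inB[_]; exact: lt_trans.
  - move=> y /inA[Ry yx]; split; last exact/fH/ltW.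
    by apply/inA; split; [exact: fR|exact: le_lt_trans (fle y) yx].
  - by apply/inA; split=> //; exact: fR.
rewrite deletion_order_complex; congr order_complex.
apply/seteqP; split=> y /=.
  case=> Ry yD; split; last by move=> yx; apply: yD; rewrite yx.
  by split=> //=; rewrite !inE => /andP[].
case=> -[Ry /= yD] yx; split=> // yD'; apply: yD.
by rewrite !inE yD' andbT; exact/eqP.
Qed.

End OrderComplexes.

(** * Reversal of the order, and the two stages combined *)

Lemma order_complex_dual (d : Order.disp_t) (P : porderType d) (Q : set P) :
  @order_complex _ P^d Q = order_complex Q :> complex P.
Proof.
apply: complex_eq; apply/seteqP; split=> s [s0 sQ sC]; split=> // x y xs ys.
  exact: sC y x ys xs.
exact: sC y x ys xs.
Qed.

(** Reversing the order makes [f] decreasing and leaves the chains unchanged. *)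
Lemma NE_reduces_increasing (d : Order.disp_t) (P : porderType d)
    (f : P -> P) (R : set P) (D : {fset P}) :
  {homo f : x y / x <= y} -> (forall x, x <= f x) ->
  (forall x, R x -> R (f x)) ->
  {in D, forall x, [/\ R x, f x <> x &
    finite_set ([set y | y < x] `|` [set y | x < y])]} ->
  NE_reduces (order_complex R) (order_complex (R `\` [set` D])).
Proof.
move=> fH fge fR DP; rewrite -(order_complex_dual R).
rewrite -(order_complex_dual (R `\` _)).
apply: (@NE_reduces_decreasing _ P^d f) => // [x y|x xD].
  exact: fH.
by have [Rx fx fin] := DP x xD; split=> //; rewrite setUC.
Qed.

Theorem theorem3p1 (d : Order.disp_t) (P : porderType d) (phi : P -> P)
    (Q : set P) :
  monotone_map phi ->
  Fix phi `<=` Q ->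
  finite_set (~` Q) ->
  (forall x, ~ Q x -> finite_set ([set y | y < x] `|` [set y | x < y])) ->
  NE_reduces (order_complex [set: P]) (order_complex Q) /\
  collapses (order_complex [set: P]) (order_complex Q).
Proof.
move=> [phiH phiM] FixQ /finite_fsetP[F FE] fin.
suff NE : NE_reduces (order_complex [set: P]) (order_complex Q).
  by split=> //; exact: NE_reduces_collapses.
have inF x : (x \in F) <-> ~ Q x by rewrite -[is_true _]/([set` F] x) -FE.
have moved x : x \in F -> phi x <> x by move=> /inF nQ /FixQ.
pose D := [fset x in F | phi x < x]%fset.
pose U := [fset x in F | x < phi x]%fset.
pose lo x := if phi x <= x then phi x else x.
pose hi x := if x <= phi x then phi x else x.
have loE x : lo x = phi x /\ phi x <= x \/ lo x = x /\ x <= phi x.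
  by rewrite /lo; case: ifP => [|h]; [left|right]; case: (phiM x) => //; rewrite h.
have hiE x : hi x = phi x /\ x <= phi x \/ hi x = x /\ phi x <= x.
  by rewrite /hi; case: ifP => [|h]; [left|right]; case: (phiM x) => //; rewrite h.
apply: (@rt_trans _ _ _ (order_complex (setT `\` [set` D]))).
  apply: (@NE_reduces_decreasing _ _ lo) => // [x y xy|x|x].
  (* In the mixed cases [lo] preserves order by [phi x <= x <= y] or by [x <= phi x <= phi y]. *)
  - have := phiH _ _ xy.
    case: (loE x) (loE y) => [[-> hx]|[-> hx]] [[-> hy]|[-> hy]] // h.
      exact: le_trans hx xy.
    exact: le_trans hx h.
  - by case: (loE x) => [[->]|[->]].
  - rewrite !inE /= => /andP[xF px]; split=> //; last exact/fin/inF.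
    by rewrite /lo (ltW px); exact: moved.
(* A point outside [Q] is not fixed, so it is moved strictly down or strictly up. *)
have -> : Q = (setT `\` [set` D]) `\` [set` U].
  apply/seteqP; split=> x /=.
    by move=> Qx; do ?split=> //; rewrite !inE /= => /andP[/inF].
  case=> -[_ /= xD] xU; apply: contrapT => /inF xF.
  have /eqP px := moved x xF.
  case: (phiM x) => h; [apply: xD|apply: xU]; rewrite !inE xF /=.
    by rewrite lt_neqAle px.
  by rewrite lt_neqAle eq_sym px.
apply: (@NE_reduces_increasing _ _ hi) => // [x y xy|x|x [_ /= xD]|x].
- have := phiH _ _ xy.
  case: (hiE x) (hiE y) => [[-> hx]|[-> hx]] [[-> hy]|[-> hy]] // h.
    exact: le_trans h hy.
  exact: le_trans xy hy.
- by case: (hiE x) => [[->]|[->]].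
(* From [x <= phi x] follows [phi x <= phi (phi x)], so [hi] does not lead back into [D]. *)
- case: (hiE x) => [[-> hx]|[-> _]] //; split=> //=.
  rewrite !inE /= => /andP[_ /(lt_le_trans)/(_ (phiH _ _ hx))].
  by rewrite ltxx.
- rewrite !inE /= => /andP[xF px]; split; last exact/fin/inF.
    by split=> //=; rewrite !inE /= => /andP[_ /(lt_trans px)]; rewrite ltxx.
  by rewrite /hi (ltW px); exact: moved.
Qed.
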